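(* Let $k,a,b,c,r$ be integers with $k\geq c>b>a\geq 1$ and $r\geq 1$. Let $\mathcal{R}_{a,b,c,k}$ be the set of partitions $\pi=(\pi_1,\ldots,\pi_m)$ ($\pi_1\geq\cdots\geq\pi_m$, including the empty partition) such that every part is congruent to $a$, $b$ or $c$ modulo $k$, the parts congruent to $c$ modulo $k$ are distinct, and for $1\leq i<m$, if $\pi_i\equiv a\pmod k$ then $\pi_{i+1}$ is congruent to $a$ or $c$ modulo $k$. Let $\mathcal{R}_{a,b,c,k,r}$ be the set of partitions in $\mathcal{R}_{a,b,c,k}$ for which there is no index $i$ with $\pi_i,\pi_{i+1},\ldots,\pi_{i+r-1}$ all congruent to $b$ modulo $k$. Then \begin{align*} &\sum_{\pi\in\mathcal{R}_{a,b,c,k}}\mu^{\ell_{k,a}(\pi)}\nu^{\ell_{k,b}(\pi)}\omega^{\ell_{k,c}(\pi)}q^{|\pi|}\\ &=1+\sum_{m\geq 1}\frac{1}{(q^k;q^k)_m}\sum_{s,h\geq 0}\mu^{m-h-s}\nu^{h}\omega^sq^{(m-h-s)a+hb+sc+k(s^2-s)/2}{{h+s}\brack {s}}_{k}{{m-h}\brack {s}}_{k}, \end{align*} and \begin{align*} &\sum_{\pi\in\mathcal{R}_{a,b,c,k,r}}\mu^{\ell_{k,a}(\pi)}\nu^{\ell_{k,b}(\pi)}\omega^{\ell_{k,c}(\pi)}q^{|\pi|}\\ &=1+\sum_{m\geq 1}\frac{1}{(q^k;q^k)_m}\sum_{s,h\geq 0}\mu^{m-h-s}\nu^{h}\omega^sq^{(m-h-s)a+hb+sc+k(s^2-s)/2}{{m-h}\brack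 {s}}_{k}\\ &\qquad\qquad\times\sum_{i\geq 0}(-1)^iq^{rk(i^2-i)/2}{{s+1}\brack {i}}_{rk}{{h-ri+s}\brack {s}}_{k}. \end{align*}
   Context: Partitions are finite non-increasing sequences of positive integers; $|\pi|$ is the sum of the parts; for $k\geq d\geq 1$, $\ell_{k,d}(\pi)$ denotes the number of parts of $\pi$ congruent to $d$ modulo $k$. $|q|<1$. $(x;q)_0=1$, $(x;q)_n=(1-x)(1-xq)\cdots(1-xq^{n-1})$. For a positive integer $k$ and integers $A,B$, ${A\brack B}_k=\frac{(q^k;q^k)_A}{(q^k;q^k)_B(q^k;q^k)_{A-B}}$ if $A\geq B\geq 0$, and $0$ otherwise. *)

(* Defs.v *)
From HB Require Import structures.
From mathcomp Require Export all_boot all_order all_algebra.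
From mathcomp Require Export complex finmap.
From mathcomp Require Export all_classical all_reals all_analysis.
From mathcomp.analysis.showcase Require summability.

Set Implicit Arguments.
Unset Strict Implicit.
Unset Printing Implicit Defensive.

Export Order.TTheory GRing.Theory Num.Theory.
Export numFieldNormedType.Exports.

Local Open Scope classical_set_scope.
Local Open Scope ring_scope.
Local Open Scope complex_scope.

Definition is_partition (p : seq nat) : Prop :=
  sorted geq p /\ (0%N \notin p).

Definition ell (k d : nat) (p : seq nat) : nat :=
  count (fun x => x == d %[mod k])%N p.

(* Indices are 0-based: the i-th entry is the (i+1)-st part. *)
Definition Rset (a b c k : nat) : set (seq nat) :=
  [set p | [/\ is_partition p,
      (forall x, x \in p ->
         [\/ x = a %[mod k], x = b %[mod k] | x = c %[mod k]])%N,
      uniq [seq x <- p | (x == c %[mod k])%N] &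
      (forall i, (i.+1 < size p)%N ->
         nth 0 p i = a %[mod k] ->
         nth 0 p i.+1 = a %[mod k] \/ nth 0 p i.+1 = c %[mod k])%N]].

Definition Rset_run (a b c k r : nat) : set (seq nat) :=
  [set p | Rset a b c k p /\
     ~ (exists i, (i + r <= size p)%N /\
          forall j, (j < r)%N -> (nth 0 p (i + j) = b %[mod k])%N)].

Section QSeries.
Variable K : fieldType.

Definition qpoch (x q : K) (n : nat) : K := \prod_(i < n) (1 - x * q ^+ i).

Definition qbin (q : K) (k : nat) (A B : int) : K :=
  if 0 <= B <= A then
    qpoch (q ^+ k) (q ^+ k) `|A|%N /
      (qpoch (q ^+ k) (q ^+ k) `|B|%N * qpoch (q ^+ k) (q ^+ k) `|A - B|%N)
  else 0.

Variables (k a b c : nat) (q mu nu om : K).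

Definition weight (p : seq nat) : K :=
  mu ^+ ell k a p * nu ^+ ell k b p * om ^+ ell k c p * q ^+ sumn p.

Definition monomial (m s h : nat) : K :=
  mu ^+ (m - h - s) * nu ^+ h * om ^+ s *
  q ^+ ((m - h - s) * a + h * b + s * c + k * ((s ^ 2 - s) %/ 2)).

(* The sums over s, h >= 0 run over h + s <= m only: when h + s > m the factor
   qbin q k (m - h) s is 0.  On this range the subtractions in monomial are
   exact.  Likewise qbin q (r * k) (s + 1) i is 0 for i > s + 1. *)
Definition term (m : nat) : K :=
  (qpoch (q ^+ k) (q ^+ k) m)^-1 *
  \sum_(s < m.+1) \sum_(h < (m - s).+1)
    monomial m s h * qbin q k (h%:Z + s%:Z) s%:Z * qbin q k (m%:Z - h%:Z) s%:Z.

Definition term_run (r m : nat) : K :=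
  (qpoch (q ^+ k) (q ^+ k) m)^-1 *
  \sum_(s < m.+1) \sum_(h < (m - s).+1)
    monomial m s h * qbin q k (m%:Z - h%:Z) s%:Z *
    \sum_(i < s.+2)
      (-1) ^+ i * q ^+ (r * k * ((i ^ 2 - i) %/ 2)) *
      qbin q (r * k) (s%:Z + 1) i%:Z *
      qbin q k (h%:Z - r%:Z * i%:Z + s%:Z) s%:Z.

End QSeries.

(* Convergence of the sum of f over the possibly infinite index set A along the
   net of finite subsets of A, i.e. unconditional (equivalently, absolute)
   convergence.  R[i]^o is R[i] with the topology of its modulus. *)
Definition sums_to (R : realType) (T : choiceType) (A : set T)
    (f : T -> R[i]) (S : R[i]) : Prop :=
  (summability.partial_sum (fun x : A => f (val x)) : {fset A} -> R[i]^o)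
    @ summability.totally --> (S : R[i]^o).

Definition series_from1_to (R : realType) (t : nat -> R[i]) (S : R[i]) : Prop :=
  (fun n => \sum_(1 <= m < n) t m : R[i]^o) @ \oo --> (S : R[i]^o).

(* Main.v *)
Require Import Defs.
From mathcomp Require Import ring lra zify.

Set Implicit Arguments.
Unset Strict Implicit.
Unset Printing Implicit Defensive.

Import summability ComplexField.Normc.

Local Open Scope ring_scope.
Local Open Scope complex_scope.

(** Write each part as [k * j + d] with [d] one of [a], [b], [c]. Along a
    partition in the set, the quotients [j] weakly decrease, and strictly so
    exactly in front of a part of class [c]; the word of classes is any word
    without the factor [ab]. For a word of length [m] with its [c]'s at the
    (0-based) positions [P], the quotients thus contribute [Q ^ (sum of P)]
    divided by [(Q; Q)_m], where [Q = q ^ k]. A word with [s] letters [c]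
    splits into [s + 1] segments [b...ba...a], and summing [Q ^ (sum of P)]
    over the distributions of the [a]'s and of the [b]'s among the segments
    gives the two q-binomials. When at most [r - 1] letters [b] fit into a
    segment, the generating function of the [b]-distribution is multiplied by
    [prod_(j <= s) (1 - (z Q^j)^r)], which the q-binomial theorem expands into
    the alternating sum. The first identity is, in length [m], the second one
    with [r > m].

    Convergence: with the quotients bounded by [L], the sum over partitions of
    length [m] is a finite combination of q-binomials, which tends to the
    [m]-th term as [L] grows; the same computation with absolute values gives
    a uniform bound on all finite sums. *)

(** * Gaussian binomials *)

Definition not_unity_root (K : nzRingType) (x : K) : Prop :=
  forall i, 1 - x ^+ i.+1 != 0.

Lemma norm_lt1_not_unity_root (K : numDomainType) (x : K) :
  `|x| < 1 -> not_unity_root x.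
Proof.
move=> x_lt1 i; rewrite subr_eq0; apply: contraTneq (x_lt1) => x_i1.
have : `|x ^+ i.+1| < 1 by rewrite normrX exprn_ilt1.
by rewrite -x_i1 normr1 ltxx.
Qed.

(* With an integer upper index both Pascal rules hold without side conditions. *)
Definition qbinom (K : fieldType) (Q : K) (n : int) (m : nat) : K :=
  qbin Q 1 n m%:Z.

Section GaussianBinomials.
Variables (K : fieldType) (Q : K).
Hypothesis Q_not_unity : not_unity_root Q.

Lemma qpochS n : qpoch Q Q n.+1 = qpoch Q Q n * (1 - Q ^+ n.+1).
Proof. by rewrite /qpoch big_ord_recr /= exprS. Qed.

Lemma qpoch_neq0 n : qpoch Q Q n != 0.
Proof. by apply/prodf_neq0 => i _; rewrite -exprS. Qed.

Lemma qpochD n m : qpoch Q Q (n + m) = qpoch Q Q n * qpoch (Q ^+ n.+1) Q m.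
Proof.
rewrite /qpoch big_split_ord /=; congr (_ * _).
by apply: eq_bigr => i _; rewrite -exprD -exprS addSn.
Qed.

Lemma qbinom_eq0 (n : int) m : n < m%:Z -> qbinom Q n m = 0.
Proof. by move=> lt_nm; rewrite /qbinom /qbin ifF //; lia. Qed.

Lemma qbinom_qpoch d m :
  qbinom Q (d + m)%N m = qpoch Q Q (d + m) / (qpoch Q Q m * qpoch Q Q d).
Proof.
rewrite /qbinom /qbin ifT; last by lia.
by have -> : (d + m)%N%:Z - m%:Z = d by lia.
Qed.

Lemma qbinom_qpoch_shift d m :
  qbinom Q (d + m)%N m = qpoch (Q ^+ d.+1) Q m / qpoch Q Q m.
Proof.
rewrite qbinom_qpoch qpochD [qpoch Q Q m * _]mulrC -mulf_div.
by rewrite divff ?mul1r ?qpoch_neq0.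
Qed.

Lemma qbinomn0 (n : nat) : qbinom Q n 0 = 1.
Proof. by have := qbinom_qpoch_shift n 0; rewrite addn0 /qpoch !big_ord0 divr1. Qed.

Lemma qbinomnn (n : nat) : qbinom Q n n = 1.
Proof. by have := qbinom_qpoch_shift 0 n; rewrite expr1 divff ?qpoch_neq0. Qed.

Lemma qbinom_neighbours (n : int) m : exists x,
  [/\ qbinom Q (n + 1) m.+1 = x * (1 - Q ^+ `|n - m%:Z| * Q ^+ m.+1),
      qbinom Q n m.+1 = x * (1 - Q ^+ `|n - m%:Z|) &
      qbinom Q n m = x * (1 - Q ^+ m.+1)].
Proof.
case: (ltP n m%:Z) => [lt_nm|]; last rewrite -subr_ge0 => /gez0_abs.
  by exists 0; rewrite !mul0r !qbinom_eq0; [|lia..].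
case: `|n - m%:Z|%N => [|d].
  move/eqP; rewrite eq_sym subr_eq0 => /eqP ->.
  exists (1 - Q ^+ m.+1)^-1; rewrite expr0 mul1r subrr mulr0 mulVf //.
  by rewrite addrC -intS !qbinomnn qbinom_eq0 ?ltz_nat.
move/eqP; rewrite eq_sym subr_eq => /eqP ->.
exists (qpoch Q Q (d.+1 + m) / (qpoch Q Q m.+1 * qpoch Q Q d.+1)).
have -> : d.+1%:Z + m%:Z + 1 = (d.+1 + m.+1)%N by lia.
rewrite -PoszD [in X in [/\ _, X & _]]addSnnS !qbinom_qpoch.
rewrite -exprD addnS addSn !qpochS.
by split; field; rewrite ?qpoch_neq0 ?Q_not_unity.
Qed.

Lemma qbinomS (n : int) m :
  qbinom Q (n + 1) m.+1 = qbinom Q n m + Q ^+ m.+1 * qbinom Q n m.+1.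
Proof. by have [x [-> -> ->]] := qbinom_neighbours n m; ring. Qed.

Lemma qbinomS_dual (n : int) m :
  qbinom Q (n + 1) m.+1 = qbinom Q n m.+1 + Q ^+ `|n - m%:Z| * qbinom Q n m.
Proof. by have [x [-> -> ->]] := qbinom_neighbours n m; ring. Qed.

Lemma qbinom_hockey_stick m s L :
  \sum_(j < L) Q ^+ j * qbinom Q (j%:Z - s%:Z + m%:Z) m =
  Q ^+ s * qbinom Q (L%:Z - s%:Z + m%:Z) m.+1.
Proof.
elim: L => [|L IH].
  by rewrite big_ord0 qbinom_eq0 ?mulr0 //; lia.
rewrite big_ord_recr IH /=.
have -> : L.+1%:Z - s%:Z + m%:Z = L%:Z - s%:Z + m%:Z + 1 by lia.
rewrite qbinomS_dual mulrDr mulrA -exprD; congr (_ + _).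
case: (leqP s L) => [le_sL|lt_Ls]; last by rewrite qbinom_eq0 ?mulr0 //; lia.
by congr (_ ^+ _ * _); lia.
Qed.

End GaussianBinomials.

Lemma eq_coefM (K : comNzRingType) (p u v : {poly K}) n :
  (forall i, (i <= n)%N -> u`_i = v`_i) -> (p * u)`_n = (p * v)`_n.
Proof.
by move=> eq_uv; rewrite !coefM; apply: eq_bigr => i _; rewrite eq_uv ?leq_subr.
Qed.

Lemma coef_onemZXM (K : comNzRingType) (c : K) (p : {poly K}) n :
  ((1 - c *: 'X) * p)`_n = p`_n - c * ('X * p)`_n.
Proof. by rewrite mulrBl mul1r -scalerAl coefB coefZ. Qed.

Definition qpochX (K : comNzRingType) (Q : K) (s : nat) : {poly K} :=
  \prod_(i < s) (1 - Q ^+ i *: 'X).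

Section QBinomialTheorem.
Variables (K : fieldType) (Q : K).
Hypothesis Q_not_unity : not_unity_root Q.

Lemma coef_qpochX s i :
  (qpochX Q s)`_i = (-1) ^+ i * Q ^+ 'C(i, 2) * qbinom Q s i.
Proof.
elim: s i => [|s IH] i.
  rewrite /qpochX big_ord0 coef1; case: i => [|i].
    by rewrite qbinomn0 ?mulr1.
  by rewrite qbinom_eq0 ?mulr0.
rewrite /qpochX big_ord_recr /= mulrC coef_onemZXM -/(qpochX Q s) coefXM !IH.
case: i => [|i] /=; first by rewrite !qbinomn0 // mulr0 subr0.
rewrite intS [1 + _]addrC qbinomS_dual // mulrDr; congr (_ + _).
case: (leqP i s) => [le_is|lt_si]; last by rewrite qbinom_eq0 ?mulr0 ?oppr0.
have -> : `|s%:Z - i%:Z|%N = (s - i)%N by lia.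
have Q_s : Q ^+ s = Q ^+ i * Q ^+ (s - i) by rewrite -exprD subnKC.
by rewrite binS bin1 exprD exprS Q_s; ring.
Qed.

Lemma qpochXE s :
  qpochX Q s = \poly_(i < s.+1) ((-1) ^+ i * Q ^+ 'C(i, 2) * qbinom Q s i).
Proof.
apply/polyP => i; rewrite coef_qpochX coef_poly.
by case: ltnP => // lt_si; rewrite qbinom_eq0 ?mulr0 // ltz_nat.
Qed.

(* The polynomial truncates the power series [1 / qpochX Q s.+1]. *)
Lemma coef_qpochX_inv s N n : (n < N)%N ->
  (qpochX Q s.+1 * \poly_(i < N) qbinom Q (i + s)%N s)`_n = (n == 0%N)%:R.
Proof.
elim: s n => [|s IH] n lt_nN.
  rewrite /qpochX big_ord1 coef_onemZXM coefXM !coef_poly lt_nN expr0 mul1r.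
  case: n lt_nN => [|n] lt_nN /=; rewrite ?(ltnW lt_nN) !addn0 !qbinomn0 //.
    by rewrite subr0.
  by rewrite subrr.
rewrite /qpochX big_ord_recr /= -mulrA -IH //; apply: eq_coefM => i le_in.
rewrite coef_onemZXM coefXM !coef_poly.
have lt_iN : (i < N)%N by lia.
rewrite lt_iN; case: i lt_iN {le_in} => [|i] lt_iN /=.
  by rewrite mulr0 subr0 !qbinomnn.
rewrite (ltnW lt_iN).
have -> : (i.+1 + s.+1)%N%:Z = (i + s.+1)%N%:Z + 1 by lia.
by rewrite qbinomS // addSnnS addrK.
Qed.

End QBinomialTheorem.

(** * Bounded runs *)

(* [run_poly Q e s] counts the tuples [(h_0, ..., h_(s-1))] with all [h_i <= e]
   by their sum, with the weight [Q ^ (\sum_i i * h_i)]. In [lead_run_poly] there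
   is one more entry [h_s <= t]. *)
Section BoundedRuns.
Variables (K : comNzRingType) (Q : K).

Definition geom_poly (c : K) (e : nat) : {poly K} := \sum_(j < e.+1) (c *: 'X) ^+ j.

Definition run_poly (e s : nat) : {poly K} := \prod_(i < s) geom_poly (Q ^+ i) e.

Definition lead_run_poly (e t s : nat) : {poly K} :=
  run_poly e s * geom_poly (Q ^+ s) t.

Lemma run_polyS e s : run_poly e s.+1 = lead_run_poly e e s.
Proof. by rewrite /run_poly big_ord_recr. Qed.

Lemma coef_lead_run_poly e t s n :
  (lead_run_poly e t s)`_n = (run_poly e s)`_n +
    (if (t, n) is (t'.+1, n'.+1) then Q ^+ s * (lead_run_poly e t' s)`_n' else 0).
Proof.
rewrite /lead_run_poly /geom_poly big_ord_recl expr0 mulrDr mulr1 coefD.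
congr (_ + _); case: t => [|t]; first by rewrite big_ord0 mulr0 coef0.
under eq_bigr do rewrite lift0 exprS.
rewrite -big_distrr mulrCA -scalerAl coefZ coefXM.
by case: n => //=; rewrite mulr0.
Qed.

Lemma coef_lead_run_poly0 e s n : (lead_run_poly e 0 s)`_n = (run_poly e s)`_n.
Proof. by rewrite coef_lead_run_poly addr0. Qed.

Lemma coef0_lead_run_poly e t s : (lead_run_poly e t s)`_0 = 1.
Proof.
have head_geom c t' : (geom_poly c t')`_0 = 1.
  by rewrite /geom_poly big_ord_recl coefD coef1 coef_sum big1 ?addr0 // => i _;
     rewrite lift0 exprS -scalerAl coefZ coefXM mulr0.
rewrite /lead_run_poly coef0M head_geom mulr1 /run_poly.
by elim/big_ind: _ => // [|p u p0 u0]; rewrite ?coef1 // coef0M p0 u0 mulr1.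
Qed.

Lemma qpochXM_run_poly e s :
  qpochX Q s * run_poly e s = qpochX (Q ^+ e.+1) s \Po 'X^(e.+1).
Proof.
rewrite /qpochX /run_poly -big_split rmorph_prod; apply: eq_bigr => i _ /=.
rewrite rmorphB rmorph1 /= comp_polyZ comp_polyX exprAC -exprZn.
by rewrite -[RHS]opprB subrX1 -mulNr opprB.
Qed.

End BoundedRuns.

Section BoundedRunCounts.
Variables (K : fieldType) (Q : K).
Hypothesis Q_not_unity : not_unity_root Q.

Lemma not_unity_rootX r : not_unity_root (Q ^+ r.+1).
Proof. by move=> i; rewrite -exprM mulnS addSn. Qed.

Lemma coef_run_poly e s n : (run_poly Q e s.+1)`_n =
  \sum_(i < s.+2) (-1) ^+ i * (Q ^+ e.+1) ^+ 'C(i, 2) *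
    qbinom (Q ^+ e.+1) s.+1 i * qbinom Q (n%:Z - (e.+1 * i)%N%:Z + s%:Z) s.
Proof.
set D := \poly_(i < n.+1) qbinom Q (i + s)%N s.
have -> : (run_poly Q e s.+1)`_n = (run_poly Q e s.+1 * (qpochX Q s.+1 * D))`_n.
  rewrite -[in LHS](mulr1 (run_poly Q e s.+1)); apply: eq_coefM => i le_in.
  by rewrite coef_qpochX_inv // coef1.
rewrite mulrCA mulrA qpochXM_run_poly (qpochXE (not_unity_rootX e)) poly_def.
rewrite rmorph_sum mulr_suml coef_sum.
apply: eq_bigr => i _; rewrite /= comp_polyZ rmorphXn /= comp_polyX.
rewrite -[in 'X^_ ^+ _]exprM -scalerAl coefZ coefXnM coef_poly; congr (_ * _).
case: ltnP => [lt_ni|le_in]; first by rewrite qbinom_eq0 //; lia.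
by rewrite ltnS leq_subr; congr (qbinom Q _ s); lia.
Qed.

Lemma coef_run_poly_unbounded e s n : (n <= e)%N ->
  (run_poly Q e s.+1)`_n = qbinom Q (n + s)%N s.
Proof.
move=> le_ne; rewrite coef_run_poly big_ord_recl big1 ?addr0 => [|i _].
  by rewrite muln0 subr0 -PoszD (qbinomn0 (not_unity_rootX e)) ?bin0n ?mul1r.
by rewrite lift0 mulnS [qbinom Q _ s]qbinom_eq0 ?mulr0 //; lia.
Qed.

End BoundedRunCounts.

(** * Words of residue classes *)

Lemma big_ord_shift (V : nmodType) N (F : nat -> V) : F N = 0 ->
  \sum_(i < N.+1) (if nat_of_ord i is i'.+1 then F i' else 0) = \sum_(i < N.+1) F i.
Proof. by move=> FN; rewrite big_ord_recl big_ord_recr FN /= add0r addr0. Qed.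

Section Words.
Variables (K : fieldType) (Q : K) (e : nat).
Hypothesis Q_not_unity : not_unity_root Q.

(* The sum of [Q] to the sum of the (0-based) positions of the [c]'s over the
   words of length [m] with [s] letters [c] and [h] letters [b], without the
   factor [ab], whose leading run of [b]'s has at most [t] letters and whose
   other runs of [b]'s have at most [e]. *)
Definition word_gf (m t s h : nat) : K :=
  Q ^+ 'C(s, 2) * qbinom Q (m%:Z - h%:Z) s * (lead_run_poly Q e t s)`_h.

Lemma word_gf_eq0 m t s h : (m < h + s)%N -> word_gf m t s h = 0.
Proof. by move=> lt_m; rewrite /word_gf qbinom_eq0 ?mulr0 ?mul0r //; lia. Qed.

Lemma word_gf0 t : word_gf 0 t 0 0 = 1.
Proof. by rewrite /word_gf coef0_lead_run_poly subrr qbinomn0 // !mulr1. Qed.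

Lemma word_gfS m t s h : word_gf m.+1 t s h = Q ^+ s * word_gf m 0 s h
  + (if (t, h) is (t'.+1, h'.+1) then Q ^+ s * word_gf m t' s h' else 0)
  + (if s is s'.+1 then Q ^+ s' * word_gf m e s' h else 0).
Proof.
rewrite /word_gf coef_lead_run_poly coef_lead_run_poly0 mulrDr addrAC.
congr (_ + _); last first.
  case: t h => [|t] [|h]; rewrite ?mulr0 //.
  by have -> : m.+1%:Z - h.+1%:Z = m%:Z - h%:Z by [lia]; ring.
have -> : m.+1%:Z - h%:Z = m%:Z - h%:Z + 1 by lia.
case: s => [|s]; last first.
  by rewrite -run_polyS qbinomS // binS bin1 exprD; ring.
rewrite /run_poly big_ord0 coef1; case: h => [|h]; last by rewrite !mulr0 addr0.
have -> : m%:Z - 0%:Z + 1 = m.+1%:Z by lia.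
by rewrite subr0 !qbinomn0 // expr0 addr0 !mul1r.
Qed.

Variables (A B C : K).

Definition word_term (m t s h : nat) : K :=
  A ^+ (m - h - s) * B ^+ h * C ^+ s * word_gf m t s h.

Lemma word_term_eq0 m t s h : (m < h + s)%N -> word_term m t s h = 0.
Proof. by move=> lt_m; rewrite /word_term word_gf_eq0 ?mulr0. Qed.

Lemma word_termS m t s h : word_term m.+1 t s h =
  A * (Q ^+ s * word_term m 0 s h)
  + (if (t, h) is (t'.+1, h'.+1) then B * (Q ^+ s * word_term m t' s h') else 0)
  + (if s is s'.+1 then C * (Q ^+ s' * word_term m e s' h) else 0).
Proof.
rewrite /word_term word_gfS !mulrDr; congr (_ + _ + _).
- case: (leqP (h + s) m) => [le_hsm|lt_mhs]; last first.
    by rewrite word_gf_eq0 //; ring.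
  have -> : (m.+1 - h - s = (m - h - s).+1)%N by lia.
  by rewrite exprS; ring.
- case: t h => [|t] [|h]; rewrite ?mulr0 //.
  by rewrite exprS subSS; ring.
- case: s => [|s]; rewrite ?mulr0 //.
  have -> : (m.+1 - h - s.+1 = m - h - s)%N by lia.
  by rewrite exprS; ring.
Qed.

(* [N] is any bound on the length: [word_term m t s h] is 0 for [s] or [h] above
   [m], and a range independent of [m] lets sums over [m] be exchanged. *)
Variable N : nat.

Definition word_sum (m t : nat) (g : nat -> K) : K :=
  \sum_(s < N) \sum_(h < N) word_term m t s h * g s.

Lemma eq_word_sum m t g g' : g =1 g' -> word_sum m t g = word_sum m t g'.
Proof. by move=> gg'; apply: eq_bigr => s _; apply: eq_bigr => h _; rewrite gg'. Qed.

Lemma sum_word_sum m t n (x : nat -> K) (g : nat -> nat -> K) :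
  \sum_(j < n) x j * word_sum m t (g^~ j) =
  word_sum m t (fun s => \sum_(j < n) x j * g s j).
Proof.
under eq_bigr => j _ do rewrite /word_sum big_distrr /=.
rewrite exchange_big; apply: eq_bigr => s _ /=.
under eq_bigr => j _ do rewrite big_distrr /=.
rewrite exchange_big; apply: eq_bigr => h _ /=.
by rewrite big_distrr; apply: eq_bigr => j _ /=; ring.
Qed.

Lemma word_sum0 t g : (0 < N)%N -> word_sum 0 t g = g 0%N.
Proof.
rewrite /word_sum; case: N => // n _.
rewrite big_ord_recl big_ord_recl /= {1}/word_term word_gf0 !mul1r.
rewrite !big1 ?addr0 // => [s|h] _.
  by rewrite big1 // => h _; rewrite word_term_eq0 ?mul0r ?addnS.
by rewrite word_term_eq0 ?mul0r.
Qed.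

(* Removal of the first letter. *)
Lemma word_sumS m t g : (m.+1 < N)%N -> word_sum m.+1 t g =
  A * word_sum m 0 (fun s => Q ^+ s * g s)
  + (if t is t'.+1 then B * word_sum m t' (fun s => Q ^+ s * g s) else 0)
  + C * word_sum m e (fun s => Q ^+ s * g s.+1).
Proof.
rewrite /word_sum; case: N => // n lt_mn.
under eq_bigr => s _ do under eq_bigr => h _ do rewrite word_termS !mulrDl.
under eq_bigr do rewrite !big_split /=; rewrite !big_split /=.
congr (_ + _ + _).
- rewrite big_distrr; apply: eq_bigr => s _; rewrite big_distrr.
  by apply: eq_bigr => h _ /=; ring.
- case: t => [|t'].
    by rewrite big1 // => s _; rewrite big1 // => h _; rewrite mul0r.
  rewrite big_distrr; apply: eq_bigr => s _; rewrite big_distrr /=.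
  pose F h := B * (word_term m t' s h * (Q ^+ s * g s)).
  rewrite -(@big_ord_shift _ _ F); last by rewrite /F word_term_eq0; [ring|lia].
  by apply: eq_bigr => h _; case: (nat_of_ord h) => [|h'] /=; rewrite /F; ring.
- pose F s := \sum_(h < n.+1) C * (word_term m e s h * (Q ^+ s * g s.+1)).
  transitivity (\sum_(s < n.+1) F s).
    rewrite -big_ord_shift; last first.
      by rewrite /F big1 // => h _; rewrite word_term_eq0; [ring|lia].
    apply: eq_bigr => s _; case: (nat_of_ord s) => [|s'] /=.
      by rewrite big1 // => h _; rewrite mul0r.
    by apply: eq_bigr => h _; ring.
  by rewrite big_distrr; apply: eq_bigr => s _; rewrite big_distrr.
Qed.

(* The generating function of the words together with weakly decreasing
   quotients [j_1, ..., j_m <= L], weighted by [Q ^ (j_1 + ... + j_m)], which drop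
   strictly in front of a [c] ([j_1 < L] if the first letter is a [c]). *)
Definition bounded_gf (m t L : nat) : K :=
  word_sum m t (fun s => qbinom Q (L%:Z - s%:Z + m%:Z) m).

Lemma bounded_gf0 t L : (0 < N)%N -> bounded_gf 0 t L = 1.
Proof. by move=> N_gt0; rewrite /bounded_gf word_sum0 // subr0 addr0 qbinomn0. Qed.

Lemma sum_bounded_gf m t L : \sum_(j < L) Q ^+ j * bounded_gf m t j =
  word_sum m t (fun s => Q ^+ s * qbinom Q (L%:Z - s%:Z + m%:Z) m.+1).
Proof.
rewrite (sum_word_sum _ _ _ (GRing.exp Q)
  (fun s j => qbinom Q (j%:Z - s%:Z + m%:Z) m)); apply: eq_word_sum => s.
exact: qbinom_hockey_stick.
Qed.

Lemma bounded_gfS m t L : (m.+1 < N)%N -> bounded_gf m.+1 t L =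
  A * (\sum_(j < L.+1) Q ^+ j * bounded_gf m 0 j)
  + (if t is t'.+1 then B * (\sum_(j < L.+1) Q ^+ j * bounded_gf m t' j) else 0)
  + C * (\sum_(j < L) Q ^+ j * bounded_gf m e j).
Proof.
move=> lt_mN; rewrite /bounded_gf word_sumS // -!/(bounded_gf _ _ _).
have shift s : L%:Z - s%:Z + m.+1%:Z = L.+1%:Z - s%:Z + m%:Z by lia.
congr (_ * _ + _ + _ * _).
- by rewrite sum_bounded_gf; apply: eq_word_sum => s; rewrite shift.
- case: t => // t; congr (_ * _).
  by rewrite sum_bounded_gf; apply: eq_word_sum => s; rewrite shift.
- rewrite sum_bounded_gf; apply: eq_word_sum => s.
  by congr (_ * qbinom Q _ _); lia.
Qed.

End Words.

Lemma half_sqr_bin2 s : ((s ^ 2 - s) %/ 2 = 'C(s, 2))%N.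
Proof. by rewrite bin2 divn2 expnS expn1 -subn1 mulnBr muln1. Qed.

Section Terms.
Variables (K : fieldType) (k a b c : nat) (q mu nu om : K).
Local Notation Q := (q ^+ k).
Hypothesis Q_not_unity : not_unity_root Q.

Lemma qbin_qbinom j n m : qbin q j n m%:Z = qbinom (q ^+ j) n m.
Proof. by []. Qed.

Lemma coef_run_poly_qbin e s h : (run_poly Q e s.+1)`_h =
  \sum_(i < s.+2) (-1) ^+ i * q ^+ (e.+1 * k * ((i ^ 2 - i) %/ 2)) *
    qbin q (e.+1 * k) (s%:Z + 1) i%:Z *
    qbin q k (h%:Z - e.+1%:Z * i%:Z + s%:Z) s%:Z.
Proof.
rewrite coef_run_poly //; apply: eq_bigr => i _.
rewrite half_sqr_bin2 !qbin_qbinom -!exprM mulnA [(k * e.+1)%N]mulnC -PoszM.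
by have -> : s%:Z + 1 = s.+1 by lia.
Qed.

Lemma term_run_word_sum e m : term_run k a b c q mu nu om e.+1 m =
  word_sum Q e (mu * q ^+ a) (nu * q ^+ b) (om * q ^+ c) m.+1 m e
    (fun=> (qpoch Q Q m)^-1).
Proof.
rewrite /term_run /word_sum big_distrr; apply: eq_bigr => s _ /=.
pose F h := (qpoch Q Q m)^-1 *
  (monomial k a b c q mu nu om m s h * qbinom Q (m%:Z - h%:Z) s *
   (run_poly Q e s.+1)`_h).
transitivity (\sum_(h < (m - s).+1) F h).
  rewrite big_distrr; apply: eq_bigr => h _.
  by rewrite /F coef_run_poly_qbin.
have le_ms : ((m - s).+1 <= m.+1)%N by rewrite ltnS leq_subr.
rewrite (big_ord_widen _ F le_ms) big_mkcond; apply: eq_bigr => h _ /=.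
case: ifPn => [_|ge_h]; last by rewrite word_term_eq0 ?mul0r //; lia.
rewrite /F /monomial /word_term /word_gf half_sqr_bin2 -run_polyS.
rewrite !exprMn !exprD -!exprM ![(a * _)%N]mulnC ![(b * _)%N]mulnC ![(c * _)%N]mulnC.
by set x := (qpoch _ _ _)^-1; ring.
Qed.

Lemma term_term_run e m : (m <= e)%N ->
  term k a b c q mu nu om m = term_run k a b c q mu nu om e.+1 m.
Proof.
move=> le_me; rewrite /term /term_run; congr (_ * _).
apply: eq_bigr => s _; apply: eq_bigr => h _.
rewrite mulrAC; congr (_ * _).
apply: etrans (coef_run_poly_qbin e s h).
by rewrite coef_run_poly_unbounded //; have := ltn_ord h; lia.
Qed.

End Terms.

(** * Enumeration of the partitions *)

Lemma eqn_mod_residue k j d d' : (0 < d <= k)%N -> (0 < d' <= k)%N ->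
  (k * j + d == d' %[mod k])%N = (d == d').
Proof.
case: d d' => [|d] [|d'] // lt_dk lt_d'k.
by rewrite mulnC modnMDl -addn1 -[d'.+1]addn1 eqn_modDr !modn_small // eqn_add2r.
Qed.

Lemma leq_residue k j d j' d' : (0 < d <= k)%N -> (0 < d' <= k)%N ->
  (k * j' + d' <= k * j + d)%N = (j' < j)%N || ((j' == j) && (d' <= d)%N).
Proof. by move=> d_range d'_range; case: (ltngtP j' j) => [?|?|->] /=; nia. Qed.

Lemma residue_inj k j d j' d' : (0 < d <= k)%N -> (0 < d' <= k)%N ->
  (k * j + d = k * j' + d')%N -> j = j' /\ d = d'.
Proof.
move=> d_range d'_range /eqP; rewrite eqn_leq !leq_residue // => le_le.
by split; lia.
Qed.

Lemma residue_decomp k d x : (0 < d <= k)%N -> (0 < x)%N ->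
  (x = d %[mod k])%N -> exists j, x = (k * j + d)%N.
Proof.
move=> d_range x_gt0 /eqP; have k_gt0 : (0 < k)%N by lia.
have x_div : x = (k * (x.-1 %/ k) + (x.-1 %% k).+1)%N.
  by rewrite addnS mulnC -divn_eq prednK.
by rewrite {1}x_div eqn_mod_residue ?ltn_pmod // => /eqP <-; exists (x.-1 %/ k)%N.
Qed.

Lemma mem_path_geq x p : path geq x p -> (x \in p) = (ohead p == Some x).
Proof.
case: p => // y p /= /andP[le_yx sorted_p].
rewrite inE (inj_eq Some_inj) [y == x]eq_sym; apply/orb_idr.
have geq_trans : transitive geq by move=> u v w /= uv wu; apply: leq_trans wu uv.
move=> /(allP (order_path_min geq_trans sorted_p)) /= le_xy.
by rewrite eqn_leq le_xy.
Qed.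

Section Rset.
Variables (k a b c : nat).
Hypotheses (a_gt0 : (0 < a)%N) (lt_ab : (a < b)%N) (lt_bc : (b < c)%N)
  (le_ck : (c <= k)%N).

Definition may_precede (x y : nat) : Prop :=
  [/\ (y <= x)%N, (x = c %[mod k] -> y < x)%N &
      (x = a %[mod k] -> y = a %[mod k] \/ y = c %[mod k])%N].

Lemma Rset_cons x p : Rset a b c k (x :: p) <->
  [/\ (0 < x)%N,
      [\/ x = a %[mod k], x = b %[mod k] | x = c %[mod k]]%N,
      Rset a b c k p &
      if p is y :: _ then may_precede x y else True].
Proof.
split.
- case=> [[sorted_xp]]; rewrite inE negb_or eq_sym -lt0n => /andP[x_gt0 p_gt0].
  move=> class_xp uniq_c next_a; split; first by [].
  + by apply: class_xp; rewrite mem_head.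
  + split=> [|y yp||i ip].
    * by split=> //; apply: path_sorted sorted_xp.
    * by apply: class_xp; rewrite inE yp orbT.
    * by move: uniq_c => /=; case: ifP => // _ /andP[].
    * exact: (next_a i.+1).
  + case: p sorted_xp uniq_c next_a {class_xp p_gt0} => // y p.
    move=> /andP[/= le_yx _] uniq_c next_a.
    split=> [//|/eqP x_c|]; last exact: (next_a 0%N).
    rewrite ltn_neqAle le_yx andbT; apply: contraTneq uniq_c => ->.
    by rewrite /= x_c /= inE eqxx.
- case=> x_gt0 class_x [[sorted_p p_gt0] class_p uniq_c next_a] head_p.
  have path_xp : path geq x p.
    by case: p sorted_p head_p {p_gt0 class_p uniq_c next_a} => //= y p -> [->].
  split=> [|y||[|i]].
  + by split=> //; rewrite inE negb_or eq_sym -lt0n x_gt0.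
  + by rewrite inE => /predU1P[-> //|]; apply: class_p.
  + rewrite /=; case: eqP => //= x_c; rewrite uniq_c mem_filter mem_path_geq //.
    rewrite andbT negb_and orbC; apply/orP; left.
    case: p head_p {sorted_p p_gt0 class_p uniq_c next_a path_xp} => //= y p.
    by case=> _ lt_yx _; rewrite (inj_eq Some_inj) ltn_eqF // lt_yx.
  + by case: p head_p {sorted_p p_gt0 class_p uniq_c next_a path_xp} => //= y p [].
  + exact: next_a.
Qed.

Lemma residue_range d : d \in [:: a; b; c] -> (0 < d <= k)%N.
Proof. by rewrite !inE; lia. Qed.

Lemma Rset_residue x p : Rset a b c k (x :: p) ->
  exists j d, d \in [:: a; b; c] /\ x = (k * j + d)%N.
Proof.
move=> /Rset_cons[x_gt0 class_x _ _].
have [d d_abc x_d] : exists2 d, d \in [:: a; b; c] & (x = d %[mod k])%N.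
  by case: class_x; [exists a|exists b|exists c]; rewrite // !inE eqxx ?orbT.
by have [j] := residue_decomp (residue_range d_abc) x_gt0 x_d; exists j, d.
Qed.

Definition leading_run (p : seq nat) : nat := find (fun x => x != b %[mod k])%N p.

(* Every part of [p] of class [c] is then of the form [k * j + c] with [j < L], and
   every part of class [a] or [b] has [j <= L]. *)
Definition below (L : nat) (p : seq nat) : bool := (head 0 p < k * L + c)%N.

Lemma may_precede_residue d d' j j' : d \in [:: a; b; c] -> d' \in [:: a; b; c] ->
  may_precede (k * j + d) (k * j' + d') <->
  (d = a -> d' <> b) /\ (k * j' + d' < k * j + c)%N.
Proof.
have eq_mod z d1 d2 : d1 \in [:: a; b; c] -> d2 \in [:: a; b; c] ->
    (k * z + d1 = d2 %[mod k])%N = (d1 = d2).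
  move=> /residue_range d1_range /residue_range d2_range; apply/propext.
  by split=> /eqP; [|move=> ?; apply/eqP]; rewrite eqn_mod_residue // => /eqP.
have [a_abc c_abc] : a \in [:: a; b; c] /\ c \in [:: a; b; c].
  by rewrite !inE !eqxx !orbT.
move=> d_abc d'_abc; rewrite /may_precede !eq_mod // ![(_ < k * _ + _)%N]ltnNge.
rewrite !leq_residue ?residue_range //; move: d_abc d'_abc; rewrite !inE.
by split; [case|split]; lia.
Qed.

Lemma Rset_cons_residue d j p : d \in [:: a; b; c] ->
  Rset a b c k ((k * j + d)%N :: p) <->
  [/\ Rset a b c k p, d = a -> leading_run p = 0%N & below j p].
Proof.
move=> d_abc; have d_range := residue_range d_abc.
have x_gt0 : (0 < k * j + d)%N by lia.
have class_x : [\/ k * j + d = a %[mod k], k * j + d = b %[mod k] |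
    k * j + d = c %[mod k]]%N.
  rewrite mulnC modnMDl; move: d_abc; rewrite !inE => /or3P[] /eqP ->.
  - exact: Or31.
  - exact: Or32.
  - exact: Or33.
rewrite Rset_cons; case: p => [|y p].
  split=> [[_ _ Rp _]|[Rp _ _]]; split=> //.
  rewrite /below /=; lia.
have head_step : Rset a b c k (y :: p) ->
    may_precede (k * j + d) y <->
    (d = a -> leading_run (y :: p) = 0%N) /\ below j (y :: p).
  move=> /Rset_residue[j' [d' [d'_abc ->]]]; rewrite may_precede_residue //.
  have b_range : (0 < b <= k)%N by lia.
  rewrite /leading_run /= eqn_mod_residue // ?residue_range //.
  by case: eqP => d'b; split=> -[da lt_x]; split=> // /da.
split=> [[_ _ Rp /head_step[]//]|[Rp da lt_x]].
by split=> //; apply/head_step.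
Qed.

Definition has_run (r : nat) (p : seq nat) : Prop :=
  exists i, (i + r <= size p)%N /\
    forall j, (j < r)%N -> (nth 0 p (i + j) = b %[mod k])%N.

Lemma leading_runP r p : reflect ((r <= size p)%N /\
  forall j, (j < r)%N -> (nth 0 p j = b %[mod k])%N) (r <= leading_run p)%N.
Proof.
apply: (iffP idP) => [le_r|[le_r run]].
  split; first exact: leq_trans le_r (find_size _ _).
  move=> j lt_jr; apply/eqP/negPn.
  by have /(before_find 0%N) -> := leq_trans lt_jr le_r.
rewrite leqNgt; apply/negP => lt_lr.
have has_p : has (fun x => x != b %[mod k])%N p.
  by rewrite has_find; apply: leq_trans lt_lr le_r.
by have := nth_find 0%N has_p; rewrite (run _ lt_lr) eqxx.
Qed.

Lemma has_run_cons r x p :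
  has_run r (x :: p) <-> (r <= leading_run (x :: p))%N \/ has_run r p.
Proof.
split=> [[[|i] [le_sz run]]|[/leading_runP[le_sz run]|[i [le_sz run]]]].
- by left; apply/leading_runP.
- by right; exists i.
- by exists 0%N.
- by exists i.+1.
Qed.

Lemma leading_run_cons_residue d j p : d \in [:: a; b; c] ->
  leading_run ((k * j + d)%N :: p) = if d == b then (leading_run p).+1 else 0%N.
Proof.
move=> /residue_range d_range; have b_range : (0 < b <= k)%N by lia.
by rewrite /leading_run /= eqn_mod_residue //; case: eqP.
Qed.

Lemma leading_run_le e p : ~ has_run e.+1 p -> (leading_run p <= e)%N.
Proof.
case: p => // x p no_run; rewrite leqNgt; apply/negP => run.
by apply/no_run/has_run_cons; left.
Qed.

Lemma below_cons_residue d j L p : d \in [:: a; b; c] ->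
  below L ((k * j + d)%N :: p) = (j < L + (d != c))%N.
Proof.
move=> d_abc; have c_range : (0 < c <= k)%N by lia.
rewrite /below /= ltnNge leq_residue // ?residue_range //.
by move: d_abc; rewrite !inE; lia.
Qed.

Section Parts.
Variable e : nat.

Definition run_after (t d : nat) : nat :=
  if d == a then 0 else if d == b then t.-1 else e.

Lemma Rset_run_cons_residue t d j p : (t <= e)%N -> d \in [:: a; b; c] ->
  Rset_run a b c k e.+1 ((k * j + d)%N :: p) /\
    (leading_run ((k * j + d)%N :: p) <= t)%N <->
  [/\ Rset_run a b c k e.+1 p, d = b -> (0 < t)%N,
      (leading_run p <= run_after t d)%N & below j p].
Proof.
move=> le_te d_abc.
have run_cons := has_run_cons e.+1 (k * j + d)%N p.
have run_d := leading_run_cons_residue j p d_abc.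
have le_p : ~ has_run e.+1 p -> (leading_run p <= e)%N := @leading_run_le e p.
split=> [[[/Rset_cons_residue[] // Rp run_a lt_p no_run] le_t]|
         [[Rp no_run] t_gt0 le_p' lt_p]].
- have no_run_p : ~ has_run e.+1 p by move=> run; apply/no_run/run_cons; right.
  have {}le_p := le_p no_run_p.
  rewrite run_d in le_t; split=> //.
    by move=> d_b; move: le_t; rewrite d_b eqxx; lia.
  by move: le_t run_a; rewrite /run_after; case: (d == b); case: eqP => // ?; lia.
- have le_t : (leading_run ((k * j + d)%N :: p) <= t)%N.
    move: le_p' t_gt0; rewrite run_d /run_after.
    by case: (d =P b) => [d_b|//]; case: (d =P a); lia.
  split=> //; split.
    apply/Rset_cons_residue => //; split=> // d_a.
    by move: le_p'; rewrite /run_after d_a eqxx leqn0 => /eqP.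
  by move/run_cons => [|//]; lia.
Qed.

Definition first_residues (t : nat) : seq nat :=
  if (0 < t)%N then [:: a; b; c] else [:: a; c].

Definition first_parts (t L : nat) : seq (nat * nat) :=
  [seq (d, j) | d <- first_residues t, j <- iota 0 (L + (d != c))].

(* In [parts m t L] the next part must be smaller than [k * L + c], and at most
   [t] parts congruent to [b] may come before the next part of another class. *)
Fixpoint parts (m t L : nat) : seq (seq nat) :=
  if m is m'.+1 then
    [seq (k * dj.2 + dj.1)%N :: p |
      dj <- first_parts t L, p <- parts m' (run_after t dj.1) dj.2]
  else [:: [::]].

Lemma mem_first_residues t d :
  (d \in first_residues t) = (d \in [:: a; b; c]) && ((d == b) ==> (0 < t)%N).
Proof. by rewrite /first_residues; case: ltnP => _; rewrite !inE; lia. Qed.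

Lemma mem_first_parts t L d j :
  ((d, j) \in first_parts t L) = (d \in first_residues t) && (j < L + (d != c))%N.
Proof.
apply/allpairsPdep/andP => [[d' [j' [d'_in]]]|[d_in lt_j]].
  by rewrite mem_iota => lt_j' [-> ->].
by exists d, j; rewrite mem_iota.
Qed.

Lemma mem_parts_cons m t L p : reflect
  (exists d j p', [/\ (d, j) \in first_parts t L, p' \in parts m (run_after t d) j &
                      p = (k * j + d)%N :: p'])
  (p \in parts m.+1 t L).
Proof.
apply: (iffP (@allpairsPdep _ (fun=> seq nat) _
  (fun dj p => (k * dj.2 + dj.1)%N :: p) _ _ _)).
  by move=> [[d j] [p' [dj_in p'_in ->]]]; exists d, j, p'.
by move=> [d [j [p' [dj_in p'_in ->]]]]; exists (d, j), p'.
Qed.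

Lemma mem_parts m t L p : (t <= e)%N -> p \in parts m t L <->
  [/\ size p = m, Rset_run a b c k e.+1 p, (leading_run p <= t)%N & below L p].
Proof.
elim: m t L p => [|m IH] t L p le_te.
  rewrite inE; split=> [/eqP ->|[/size0nil -> //]].
  split=> //; last by rewrite /below /=; lia.
  split; first by split=> // x; rewrite in_nil.
  by case=> i []; rewrite addnS.
have le_run d : (run_after t d <= e)%N.
  by rewrite /run_after; do 2?case: eqP => _; lia.
split.
- move=> /mem_parts_cons[d [j [p' [dj_in /IH[]// sz_p Rp run_p lt_p ->]]]].
  move: dj_in; rewrite mem_first_parts mem_first_residues.
  move=> /andP[/andP[d_abc d_t] lt_j].
  rewrite below_cons_residue //= sz_p.
  have [] : Rset_run a b c k e.+1 ((k * j + d)%N :: p') /\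
      (leading_run ((k * j + d)%N :: p') <= t)%N => [|Rxp run_xp] //.
  by apply/Rset_run_cons_residue => //; split=> // /eqP d_b; rewrite d_b in d_t.
- case: p => [[]//|x p] [[sz_p] Rxp run_xp lt_xp].
  have [j [d [d_abc x_jd]]] := Rset_residue Rxp.1; subst x.
  have [Rp t_gt0 run_p lt_p] :=
    (Rset_run_cons_residue j p le_te d_abc).1 (conj Rxp run_xp).
  apply/mem_parts_cons; exists d, j, p.
  rewrite mem_first_parts mem_first_residues d_abc -(below_cons_residue j L p d_abc).
  rewrite lt_xp andbT; split=> //; last exact/IH.
  by apply/implyP => /eqP.
Qed.

Lemma mem_parts_run_bound m L p : p \in parts m e L <->
  [/\ size p = m, Rset_run a b c k e.+1 p & below L p].
Proof.
rewrite mem_parts //; split=> [[]//|[sz_p Rp lt_p]].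
by split=> //; apply: leading_run_le Rp.2.
Qed.

Lemma parts_uniq m t L : uniq (parts m t L).
Proof.
elim: m t L => // m IH t L; apply: allpairs_uniq_dep => //.
- apply: allpairs_uniq_dep => [|d _|[d j] [d' j'] _ _ [-> ->]//]; last first.
    exact: iota_uniq.
  by rewrite /first_residues; case: ifP; rewrite /= !inE; lia.
- move=> [[d j] p] [[d' j'] p'].
  move=> /allpairsPdep[dj [_ [dj_in _ /(congr1 (@tag _ _)) /= djE]]].
  move=> /allpairsPdep[dj' [_ [dj'_in _ /(congr1 (@tag _ _)) /= dj'E]]].
  move: dj_in dj'_in; rewrite -djE -dj'E !mem_first_parts !mem_first_residues.
  move=> /andP[/andP[/residue_range d_range _] _].
  move=> /andP[/andP[/residue_range d'_range _] _] /=.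
  by move=> [/residue_inj[] // -> -> ->].
Qed.

End Parts.

Section Weights.
Variables (K : fieldType) (q mu nu om : K).
Local Notation wt := (weight k a b c q mu nu om).

Definition residue_weight (d : nat) : K :=
  (if d == a then mu else if d == b then nu else om) * q ^+ d.

Lemma weight_cons_residue d j p : d \in [:: a; b; c] ->
  wt ((k * j + d)%N :: p) = residue_weight d * ((q ^+ k) ^+ j * wt p).
Proof.
have [a_abc b_abc c_abc] :
    [/\ a \in [:: a; b; c], b \in [:: a; b; c] & c \in [:: a; b; c]].
  by rewrite !inE !eqxx !orbT.
move=> d_abc; rewrite /weight /ell /= !eqn_mod_residue ?residue_range //.
rewrite !exprD -exprM /residue_weight; move: d_abc; rewrite !inE.
case: (d =P a) => [->|_].
  by rewrite (ltn_eqF lt_ab) (ltn_eqF (ltn_trans lt_ab lt_bc)) /= => _; ring.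
case: (d =P b) => [->|_ /= ->] /=; last by ring.
by rewrite ltn_eqF //= => _; ring.
Qed.

Hypothesis Q_not_unity : not_unity_root (q ^+ k).

Lemma sum_weight_parts e m t L N : (m < N)%N -> \sum_(p <- parts e m t L) wt p =
  bounded_gf (q ^+ k) e (mu * q ^+ a) (nu * q ^+ b) (om * q ^+ c) N m t L.
Proof.
set gf := bounded_gf _ _ _ _ _ _; elim: m t L => [|m IH] t L lt_mN.
  by rewrite big_seq1 /gf bounded_gf0 // /weight /= !expr0 !mul1r.
transitivity (\sum_(d <- first_residues t) residue_weight d *
    \sum_(j < L + (d != c)) (q ^+ k) ^+ j * gf m (run_after e t d) j).
  rewrite /= big_allpairs_dep big_allpairs_dep /= [LHS]big_seq [RHS]big_seq.
  apply: eq_bigr => d; rewrite mem_first_residues => /andP[d_abc _].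
  rewrite -(big_mkord xpredT (fun j => (q ^+ k) ^+ j * gf m (run_after e t d) j)).
  rewrite /index_iota subn0 big_distrr; apply: eq_bigr => j _.
  rewrite -IH ?(ltnW lt_mN) // !big_distrr; apply: eq_bigr => p _.
  exact: weight_cons_residue.
rewrite /gf bounded_gfS // -/gf /first_residues /residue_weight /run_after.
have neqs : (((b == a) = false) * ((c == a) = false) * ((c == b) = false) *
    ((a == c) = false) * ((b == c) = false))%type by do !split; lia.
case: t => [|t] /=; rewrite !big_cons big_nil !eqxx !neqs /=;
  by rewrite addn1 addn0 addr0 ?addrA ?addr0.
Qed.

End Weights.

End Rset.

(** * Uniform bounds *)

Lemma geometric_sum_le (R : realFieldType) (x : R) n : 0 <= x < 1 ->
  \sum_(i < n) x ^+ i <= (1 - x)^-1.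
Proof.
move=> /andP[x_ge0 x_lt1]; rewrite -[leRHS]mul1r ler_pdivlMr ?subr_gt0 // mulrC.
by rewrite -opprB mulNr -subrX1 opprB lerBlDr lerDl exprn_ge0.
Qed.

Lemma prod_1D_le_expR (R : realType) n (x : nat -> R) : (forall i, 0 <= x i) ->
  \prod_(i < n) (1 + x i) <= expR (\sum_(i < n) x i).
Proof.
move=> x_ge0; rewrite expR_sum; apply: ler_prod => i _.
by rewrite addr_ge0 //= expR_ge1Dx.
Qed.

Lemma prod_onem_ge_expR (R : realType) n (x : nat -> R) (d : R) : d < 1 ->
  (forall i, 0 <= x i <= d) ->
  expR (- (\sum_(i < n) x i / (1 - d))) <= \prod_(i < n) (1 - x i).
Proof.
move=> d_lt1 x_le; rewrite -sumrN expR_sum; apply: ler_prod => i _.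
have /andP[x_ge0 x_led] := x_le i; have x_lt1 := le_lt_trans x_led d_lt1.
rewrite expR_ge0 expRN -[leRHS]invrK.
rewrite lef_pV2 ?posrE ?expR_gt0 ?invr_gt0 ?subr_gt0 //=.
apply: le_trans (expR_ge1Dx _); rewrite -lerBlDl.
have -> : (1 - x i)^-1 - 1 = x i / (1 - x i).
  by have : 1 - x i != 0 by [rewrite lt0r_neq0 ?subr_gt0]; move=> ?; field.
by rewrite ler_wpM2l // lef_pV2 ?posrE ?subr_gt0 // lerD2l lerN2.
Qed.

Lemma sum_shift_le (R : realDomainType) (F : nat -> R) j N : (forall i, 0 <= F i) ->
  \sum_(i < N | (j <= i)%N) F (i - j)%N <= \sum_(i < N) F i.
Proof.
move=> F_ge0; rewrite -(big_mkord _ (fun i => F (i - j)%N)) -(big_mkord xpredT F).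
have [le_jN|/ltnW le_Nj] := leqP j N; last first.
  rewrite big_nat_cond big_pred0 ?sumr_ge0 // => i; lia.
rewrite -(big_nat_widenl j 0 N xpredT) // -[X in \sum_(X <= _ < _) _]add0n big_addn.
rewrite [leRHS](big_cat_nat (leq0n (N - j)) (leq_subr _ _)) /=.
under eq_bigr do rewrite addnK.
by rewrite lerDl sumr_ge0.
Qed.

Local Notation nneg_poly := (polyOver Num.Def.nneg_num_pred).

Lemma sum_coef_le_horner (R : realDomainType) (p : {poly R}) (x : R) N :
  p \is a nneg_poly -> 0 <= x -> \sum_(i < N) x ^+ i * p`_i <= p.[x].
Proof.
move=> /polyOverP p_ge0 x_ge0; have le_size := leq_addl N (size p).
rewrite (horner_coef_wide _ le_size) big_split_ord /=.
under eq_bigr do rewrite mulrC.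
by rewrite lerDl sumr_ge0 // => i _; rewrite mulr_ge0 ?exprn_ge0 //; apply: p_ge0.
Qed.

Section UniformBounds.
Variables (R : realType) (Q : R).
Hypothesis Q_itv : 0 <= Q < 1.

Let Q_ge0 : 0 <= Q. Proof. by case/andP: Q_itv. Qed.
Let Q_lt1 : Q < 1. Proof. by case/andP: Q_itv. Qed.

Lemma onem_expr_gt0 i : 0 < 1 - Q ^+ i.+1.
Proof. by rewrite subr_gt0 exprn_ilt1. Qed.

Lemma itv_not_unity_root : not_unity_root Q.
Proof. by move=> i; apply/lt0r_neq0/onem_expr_gt0. Qed.

Let Q_not_unity := itv_not_unity_root.

Lemma qpoch_shift_itv d n : 0 <= qpoch (Q ^+ d.+1) Q n <= 1.
Proof.
have factor_itv i : 0 <= 1 - Q ^+ d.+1 * Q ^+ i <= 1.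
  rewrite -exprD addSn ltW ?onem_expr_gt0 //=.
  by rewrite lerBlDr lerDl exprn_ge0.
rewrite prodr_ge0 => [|i _]; last by case/andP: (factor_itv i).
by apply: prodr_ile1 => i _; apply: factor_itv.
Qed.

Lemma qpoch_gt0 n : 0 < qpoch Q Q n.
Proof. by apply: prodr_gt0 => i _; rewrite -exprS onem_expr_gt0. Qed.

Lemma qpoch_bounded_below : exists2 x, 0 < x & forall n, x <= qpoch Q Q n.
Proof.
exists (expR (- ((1 - Q)^-1 / (1 - Q)))) => [|n]; first exact: expR_gt0.
rewrite /qpoch; under eq_bigr do rewrite -exprS.
have expr_itv i : 0 <= Q ^+ i.+1 <= Q.
  by rewrite exprn_ge0 //= exprS ler_piMr // exprn_ile1 // ltW.
apply: le_trans (prod_onem_ge_expR n Q_lt1 expr_itv).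
rewrite ler_expR lerN2 -mulr_suml; apply: ler_wpM2r.
  by rewrite invr_ge0 subr_ge0 ltW.
apply: le_trans (geometric_sum_le n Q_itv); apply: ler_sum => i _.
by rewrite exprS ler_piMl ?exprn_ge0 // ltW.
Qed.

Lemma qbinom_ge1 d m : 1 <= qbinom Q (d + m)%N m.
Proof.
rewrite qbinom_qpoch_shift // ler_pdivlMr ?qpoch_gt0 // mul1r.
apply: ler_prod => i _; rewrite -exprS ltW ?onem_expr_gt0 //=.
by rewrite -exprD lerD2l lerN2 ler_wiXn2l ?(ltW Q_lt1) // addSn ltnS leq_addl.
Qed.

Lemma qbinom_itv (n : int) m : 0 <= qbinom Q n m <= (qpoch Q Q m)^-1.
Proof.
have inv_ge0 : 0 <= (qpoch Q Q m)^-1 by rewrite invr_ge0 ltW ?qpoch_gt0.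
case: (ltP n m%:Z) => [lt_nm|]; first by rewrite qbinom_eq0 // lexx.
rewrite -subr_ge0 => /gez0_abs /esym/eqP; rewrite subr_eq => /eqP ->.
rewrite -PoszD qbinom_qpoch_shift //.
have /andP[shift_ge0 shift_le1] := qpoch_shift_itv `|n - m%:Z| m.
by rewrite mulr_ge0 //= ler_piMl.
Qed.

Lemma horner_qpochXN x N :
  (qpochX Q N).[- x] = \sum_(i < N.+1) x ^+ i * (Q ^+ 'C(i, 2) * qbinom Q N i).
Proof.
rewrite qpochXE // horner_poly; apply: eq_bigr => i _.
by rewrite [(- x) ^+ i]exprNn -[RHS](signrMK i); ring.
Qed.

(* The q-binomial theorem at [- x] bounds the partial theta function by a product. *)
Lemma sum_expr_bin2_le x N : 0 <= x ->
  \sum_(s < N) x ^+ s * Q ^+ 'C(s, 2) <= expR (x / (1 - Q)).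
Proof.
move=> x_ge0; apply: le_trans (_ : (qpochX Q N).[- x] <= _).
  rewrite horner_qpochXN big_ord_recr /= -[leLHS]addr0; apply: lerD; last first.
    by rewrite !mulr_ge0 ?exprn_ge0 //; case/andP: (qbinom_itv N N).
  apply: ler_sum => i _; rewrite ler_wpM2l ?exprn_ge0 // ler_peMr ?exprn_ge0 //.
  by have := qbinom_ge1 (N - i) i; rewrite subnK // ltnW.
have -> : (qpochX Q N).[- x] = \prod_(i < N) (1 + x * Q ^+ i).
  rewrite /qpochX horner_prod; apply: eq_bigr => i _.
  by rewrite !hornerE mulrN opprK mulrC.
have xQ_ge0 i : 0 <= x * Q ^+ i by rewrite mulr_ge0 ?exprn_ge0.
apply: le_trans (prod_1D_le_expR N xQ_ge0) _.
by rewrite ler_expR -mulr_sumr ler_wpM2l ?geometric_sum_le.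
Qed.

Lemma geom_poly_nneg (c : R) e : 0 <= c -> geom_poly c e \is a nneg_poly.
Proof.
move=> c_ge0; rewrite /geom_poly rpred_sum // => j _.
exact/rpredX/polyOverZ/polyOverX.
Qed.

Lemma run_poly_nneg e s : run_poly Q e s \is a nneg_poly.
Proof. by apply: rpred_prod => i _; apply/geom_poly_nneg/exprn_ge0. Qed.

Lemma run_poly_mono e e' s : (e <= e')%N ->
  run_poly Q e' s - run_poly Q e s \is a nneg_poly.
Proof.
move=> le_ee'; elim: s => [|s IH]; first by rewrite /run_poly !big_ord0 subrr rpred0.
rewrite !run_polyS /lead_run_poly.
set p := run_poly Q e s in IH *; set p' := run_poly Q e' s in IH *.
set u := geom_poly _ e; set u' := geom_poly _ e'.
have -> : p' * u' - p * u = p' * (u' - u) + (p' - p) * u by ring.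
rewrite rpredD ?rpredM ?run_poly_nneg ?geom_poly_nneg ?exprn_ge0 //.
rewrite /u' /u /geom_poly -!(big_mkord xpredT (fun j => (Q ^+ s *: 'X) ^+ j)).
rewrite (big_cat_nat (leq0n e.+1)) //= [X in X - _]addrC addrK rpred_sum // => j _.
by apply/rpredX/polyOverZ/polyOverX/exprn_ge0.
Qed.

Lemma run_poly_sum_le (B x : R) e s N : 0 <= B -> \sum_(j < e.+1) B ^+ j <= x ->
  \sum_(h < N) B ^+ h * (run_poly Q e s)`_h <= x ^+ s.
Proof.
move=> B_ge0 sum_le.
apply: le_trans (sum_coef_le_horner N (run_poly_nneg e s) B_ge0) _.
rewrite /run_poly horner_prod -[s in x ^+ s]card_ord -prodr_const.
apply: ler_prod => i _; apply/andP; split.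
  exact: (rpred_horner (geom_poly_nneg e (exprn_ge0 i Q_ge0)) B_ge0).
apply: le_trans sum_le; rewrite horner_sum; apply: ler_sum => j _.
rewrite horner_exp !hornerE exprMn ler_piMl ?exprn_ge0 // -exprM.
by rewrite exprn_ile1 // ltW.
Qed.

Variables A B C : R.
Hypotheses (A_itv : 0 <= A < 1) (B_ge0 : 0 <= B) (C_ge0 : 0 <= C).

Lemma bounded_gf_term_le x e e' m s h L : (forall n, x <= qpoch Q Q n) -> 0 < x ->
    (e <= e')%N ->
  word_term Q e A B C m e s h * qbinom Q (L%:Z - s%:Z + m%:Z) m <=
  (if (h + s <= m)%N then A ^+ (m - (h + s)) else 0) *
    (x ^- 2 * (C ^+ s * Q ^+ 'C(s, 2) * (B ^+ h * (run_poly Q e' s.+1)`_h))).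
Proof.
move=> x_le x_gt0 le_ee'; have A_ge0 : 0 <= A by case/andP: A_itv.
case: ifP => [le_hsm|/negbT]; last first.
  by rewrite -ltnNge => lt_m; rewrite word_term_eq0 // !mul0r.
have qbinom_le n i : 0 <= qbinom Q n i <= x^-1.
  have /andP[-> /le_trans] := qbinom_itv n i; apply.
  by rewrite lef_pV2 ?posrE ?qpoch_gt0.
have /andP[wbin_ge0 wbin_le] := qbinom_le (m%:Z - h%:Z) s.
have /andP[pbin_ge0 pbin_le] := qbinom_le (L%:Z - s%:Z + m%:Z) m.
have coef_ge0 : 0 <= (run_poly Q e s.+1)`_h := polyOverP (run_poly_nneg e s.+1) h.
have coef_le : (run_poly Q e s.+1)`_h <= (run_poly Q e' s.+1)`_h.
  by rewrite -subr_ge0 -coefB; apply: (polyOverP (run_poly_mono s.+1 le_ee') h).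
rewrite /word_term /word_gf -run_polyS -subnDA.
set w := A ^+ _; set u := Q ^+ 'C(s, 2).
have -> : w * B ^+ h * C ^+ s *
    (u * qbinom Q (m%:Z - h%:Z) s * (run_poly Q e s.+1)`_h) *
    qbinom Q (L%:Z - s%:Z + m%:Z) m =
  w * (qbinom Q (m%:Z - h%:Z) s * qbinom Q (L%:Z - s%:Z + m%:Z) m *
    (C ^+ s * u * (B ^+ h * (run_poly Q e s.+1)`_h))) by ring.
rewrite ler_wpM2l ?exprn_ge0 // expr2 invfM ler_pM ?mulr_ge0 ?exprn_ge0 //.
  exact: ler_pM.
by rewrite ler_wpM2l ?mulr_ge0 ?exprn_ge0 // ler_wpM2l ?exprn_ge0.
Qed.

Lemma bounded_gf_sum_le (x : R) : 0 <= x -> exists M,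
  forall e : nat -> nat, {homo e : m n / (m <= n)%N} ->
    (forall n, \sum_(j < (e n).+1) B ^+ j <= x) ->
    forall N L, \sum_(m < N) bounded_gf Q (e m) A B C N m (e m) L <= M.
Proof.
move=> x_ge0; have [y y_gt0 y_le] := qpoch_bounded_below.
exists ((1 - A)^-1 * (y ^- 2 * (x * expR (C * x / (1 - Q))))).
move=> e e_homo sum_le N L.
pose u s h := y ^- 2 *
  (C ^+ s * Q ^+ 'C(s, 2) * (B ^+ h * (run_poly Q (e N) s.+1)`_h)).
have y2_ge0 : 0 <= y ^- 2 by rewrite invr_ge0 exprn_ge0 // ltW.
have u_ge0 s h : 0 <= u s h.
  rewrite !mulr_ge0 ?exprn_ge0 //.
  exact: (polyOverP (run_poly_nneg (e N) s.+1) h).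
have A_sum_ge0 : 0 <= (1 - A)^-1.
  by rewrite invr_ge0 subr_ge0 ltW //; case/andP: A_itv.
apply: le_trans (_ : \sum_(m < N) \sum_(s < N) \sum_(h < N)
  (if (h + s <= m)%N then A ^+ (m - (h + s)) else 0) * u s h <= _).
  apply: ler_sum => m _; apply: ler_sum => s _; apply: ler_sum => h _.
  by apply: bounded_gf_term_le => //; apply/e_homo/ltnW.
rewrite exchange_big; under eq_bigr do rewrite exchange_big /=.
apply: le_trans (_ : \sum_(s < N) \sum_(h < N) (1 - A)^-1 * u s h <= _).
  apply: ler_sum => s _; apply: ler_sum => h _.
  rewrite -big_distrl /= ler_wpM2r // -big_mkcond.
  apply: le_trans (geometric_sum_le N A_itv).
  apply: (sum_shift_le (F := fun i => A ^+ i)) => i.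
  by rewrite exprn_ge0 //; case/andP: A_itv.
under eq_bigr do rewrite -!big_distrr /=; rewrite -!big_distrr /=.
do 2!rewrite ler_wpM2l //.
apply: le_trans (ler_wpM2l x_ge0 (sum_expr_bin2_le N (mulr_ge0 C_ge0 x_ge0))).
rewrite big_distrr; apply: ler_sum => s _ /=.
have -> : x * ((C * x) ^+ s * Q ^+ 'C(s, 2)) = C ^+ s * Q ^+ 'C(s, 2) * x ^+ s.+1.
  by rewrite exprMn exprS; ring.
by rewrite ler_wpM2l ?mulr_ge0 ?exprn_ge0 // run_poly_sum_le.
Qed.

End UniformBounds.

(** * Unconditional sums *)

#[local] Existing Instance totally_filter.

Section SumLimits.
Local Open Scope classical_set_scope.

Lemma cvg_sum (K : numFieldType) (V : normedModType K) (T I : Type)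
    (F : set_system T) {FF : Filter F} (r : seq I) (f : I -> T -> V) (l : I -> V) :
  (forall i, f i x @[x --> F] --> l i) ->
  \sum_(i <- r) f i x @[x --> F] --> \sum_(i <- r) l i.
Proof.
by move=> f_l; apply: cvg_big => [|i _]; [exact: add_continuous|exact: f_l].
Qed.

Lemma cvg_series_behead (K : numFieldType) (u : nat -> K^o) (l : K^o) :
  \sum_(0 <= m < n) u m @[n --> \oo] --> l ->
  \sum_(1 <= m < n) u m @[n --> \oo] --> l - u 0%N.
Proof.
rewrite -cvg_shiftS -[X in _ -> X]cvg_shiftS => u_l.
under eq_fun do rewrite -[bigop _ _ _](addrK (u 0%N)) [_ + u 0%N]addrC -big_ltn //.
by apply: (@cvgB K K^o); last exact: cvg_cst.
Qed.

End SumLimits.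

Section ComplexLimits.
Local Open Scope classical_set_scope.
Variable R : realType.

Lemma normc_le_ReIm (x : R[i]) : `|x| <= (`|complex.Re x| + `|complex.Im x|)%:C.
Proof.
have normR (y : R) : `|y%:C| = `|y|%:C :> R[i].
  by rewrite normc_def /= expr0n /= addr0 sqrtr_sqr.
rewrite {1}[x]complexE; apply: le_trans (ler_normD _ _) _.
rewrite normrM !normR rmorphD /=.
have -> : `|'i%C| = 1 :> R[i].
  by rewrite normc_def /= expr0n /= add0r expr1n sqrtr1.
by rewrite mul1r.
Qed.

Lemma normc_ge_Im (x : R[i]) : `|complex.Im x|%:C <= `|x|.
Proof.
rewrite normc_def lecR -sqrtr_sqr ler_sqrt; last by rewrite addr_ge0 ?sqr_ge0.
by rewrite lerDr sqr_ge0.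
Qed.

Lemma cvg_complexP (T : Type) (F : set_system T) {FF : Filter F}
    (u : T -> R[i]) (l : R[i]) :
  (u x : R[i]^o) @[x --> F] --> (l : R[i]^o) <->
  forall eps : R, 0 < eps -> \forall x \near F, `|l - u x| <= eps%:C.
Proof.
split=> [/cvgrPdist_le u_l eps eps_gt0|u_l].
  by apply: u_l; rewrite ltcR.
apply/cvgrPdist_le => eps eps_gt0.
have epsE : (complex.Re eps)%:C = eps by apply/RRe_real/gtr0_real.
by rewrite -epsE; apply: u_l; rewrite -ltcR epsE.
Qed.

Lemma cvg_ReIm (T : Type) (F : set_system T) {FF : Filter F}
    (u : T -> R[i]) (x y : R) :
  complex.Re (u z) @[z --> F] --> x -> complex.Im (u z) @[z --> F] --> y ->
  (u z : R[i]^o) @[z --> F] --> (x +i* y : R[i]^o).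
Proof.
move=> /cvgrPdist_le u_x /cvgrPdist_le u_y; apply/cvg_complexP => eps eps_gt0.
have eps2_gt0 : 0 < eps / 2 by rewrite divr_gt0.
near=> z; apply: le_trans (normc_le_ReIm _) _.
rewrite lecR !raddfB /= [eps]splitr lerD //; near: z; [exact: u_x|exact: u_y].
Unshelve. all: by end_near. Qed.

End ComplexLimits.

Section Summability.
Local Open Scope classical_set_scope.
Variables (R : realType) (I : choiceType).

Lemma partial_sumD (V : zmodType) (f g : I -> V) J :
  partial_sum (fun i => f i + g i) J = partial_sum f J + partial_sum g J.
Proof. by rewrite /partial_sum big_split. Qed.

Lemma ler_partial_sum (f g : I -> R) J : (forall i, f i <= g i) ->
  partial_sum f J <= partial_sum g J.
Proof. by move=> le_fg; apply: ler_sum. Qed.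

Lemma partial_sum_subset (f : I -> R) (J J' : {fset I}) :
  (forall i, 0 <= f i) -> (J `<=` J')%fset -> partial_sum f J <= partial_sum f J'.
Proof.
move=> f_ge0 sub_J; rewrite /partial_sum -!(big_seq_fsetE _ _ xpredT f) /=.
have JE : [fset x in J' | x \in J]%fset = J.
  by apply/fsetP => x; rewrite !inE /=; apply/andb_idl/(fsubsetP sub_J).
by rewrite [leRHS](big_fsetID _ (mem J)) /= JE lerDl sumr_ge0.
Qed.

Lemma cvg_partial_sum_ge0 (f : I -> R) (M : R) : (forall i, 0 <= f i) ->
  (forall J, partial_sum f J <= M) -> cvg (partial_sum f @ totally).
Proof.
move=> f_ge0 f_le; have sup_f : has_sup (range (partial_sum f)).
  by split; [exists (partial_sum f fset0), fset0|exists M => _ [J _ <-]].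
apply/cvg_ex; exists (sup (range (partial_sum f))).
apply/cvgrPdist_le => eps eps_gt0.
have [_ [J0 _ <-] lt_J0] := sup_adherent eps_gt0 sup_f.
exists J0 => // J /= sub_J.
have le_sup : partial_sum f J <= sup (range (partial_sum f)).
  by apply: ub_le_sup; [exact: sup_f.2|exists J].
rewrite ger0_norm ?subr_ge0 // lerBlDr -lerBlDl.
exact: le_trans (ltW lt_J0) (partial_sum_subset f_ge0 sub_J).
Qed.

Lemma cvg_partial_sum_dominated (f g : I -> R) (M : R) : (forall i, `|f i| <= g i) ->
  (forall J, partial_sum g J <= M) -> cvg (partial_sum f @ totally).
Proof.
move=> f_le g_le.
have cvg_norm : cvg (partial_sum (fun i => `|f i|) @ totally).
  apply: (@cvg_partial_sum_ge0 _ M) => // J.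
  exact: le_trans (ler_partial_sum J f_le) (g_le J).
have cvg_Dnorm : cvg (partial_sum (fun i => f i + `|f i|) @ totally).
  apply: (@cvg_partial_sum_ge0 _ (M + M)) => [i|J].
    by rewrite -lerBlDl sub0r -normrN ler_norm.
  rewrite partial_sumD lerD //; apply: le_trans (g_le J).
    by apply: ler_partial_sum => i; apply: le_trans (ler_norm _) (f_le i).
  exact: ler_partial_sum.
have -> : partial_sum f = (fun J => partial_sum (fun i => f i + `|f i|) J -
    partial_sum (fun i => `|f i|) J).
  by apply/funext => J; rewrite partial_sumD addrK.
exact: is_cvgB.
Qed.

Lemma cvg_partial_sum_dominated_complex (f : I -> R[i]) (g : I -> R) (M : R) :
  (forall i, `|f i| <= (g i)%:C) -> (forall J, partial_sum g J <= M) ->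
  exists S : R[i], (partial_sum f J : R[i]^o) @[J --> totally] --> (S : R[i]^o).
Proof.
move=> f_le g_le.
have /cvg_ex[x Re_x] : cvg (partial_sum (fun i => complex.Re (f i)) @ totally).
  apply: cvg_partial_sum_dominated g_le => i.
  by rewrite -lecR; apply: le_trans (normc_ge_Re _) (f_le i).
have /cvg_ex[y Im_y] : cvg (partial_sum (fun i => complex.Im (f i)) @ totally).
  apply: cvg_partial_sum_dominated g_le => i.
  by rewrite -lecR; apply: le_trans (normc_ge_Im _) (f_le i).
exists (x +i* y); apply: cvg_ReIm.
  by under eq_fun do rewrite /partial_sum raddf_sum.
by under eq_fun do rewrite /partial_sum raddf_sum.
Qed.

End Summability.

Section SumsBySize.
Local Open Scope classical_set_scope.
Variables (R : realType) (T : choiceType) (A : set T) (sz : T -> nat).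
Variables (f : T -> R[i]) (g : T -> R) (M : R).
Variables (F : nat -> nat -> seq T) (t : nat -> R[i]).
Hypotheses (f_le : forall p, `|f p| <= (g p)%:C)
  (F_uniq : forall m L, uniq (F m L))
  (F_sub : forall m L p, p \in F m L -> A p /\ sz p = m)
  (F_exhausts : forall p, A p -> \forall L \near \oo, p \in F (sz p) L)
  (g_le : forall N L, \sum_(m < N) \sum_(p <- F m L) g p <= M)
  (f_cvg : forall m,
    (\sum_(p <- F m L) f p : R[i]^o) @[L --> \oo] --> (t m : R[i]^o)).

Definition listing (N L : nat) : seq T := [seq p | m <- iota 0 N, p <- F m L].

Lemma mem_listing N L p :
  (p \in listing N L) = (sz p < N)%N && (p \in F (sz p) L).
Proof.
apply/allpairsPdep/andP => [[m [p' [m_in p'_in ->]]]|[lt_N p_in]].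
  by have [_ ->] := F_sub p'_in; rewrite mem_iota in m_in.
by exists (sz p), p; rewrite mem_iota.
Qed.

Lemma listing_uniq N L : uniq (listing N L).
Proof.
apply: allpairs_uniq_dep => [|//|]; first exact: iota_uniq.
have sz_tagged u : u \in [seq existT (fun=> T) m p | m <- iota 0 N, p <- F m L] ->
    sz (tagged u) = tag u.
  by move=> /allpairsPdep[m [p [_ /F_sub[_ sz_p] ->]]].
by move=> [m p] [m' p'] /sz_tagged/= <- /sz_tagged/= <- ->.
Qed.

Definition listed (N L : nat) : {fset A} :=
  [fset x in pmap insub (listing N L)]%fset.

Lemma mem_listed N L (x : A) : (x \in listed N L) = (val x \in listing N L).
Proof. by rewrite !inE mem_pmap_sub. Qed.

Lemma partial_sum_listed (V : zmodType) (h : T -> V) N L :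
  partial_sum (fun x : A => h (val x)) (listed N L) =
  \sum_(m < N) \sum_(p <- F m L) h p.
Proof.
rewrite /partial_sum -(big_seq_fsetE _ _ xpredT (fun x : A => h (val x))) /=.
transitivity (\sum_(p <- listing N L) h p).
  rewrite -(big_map (val : A -> T) xpredT h); apply/perm_big/uniq_perm => [||p].
  - by rewrite map_inj_uniq ?fset_uniq //; exact: val_inj.
  - exact: listing_uniq.
  apply/mapP/idP => [[x + ->]|p_in]; first by rewrite mem_listed.
  have [_ p_F] := andP (etrans (esym (mem_listing N L p)) p_in).
  have p_A : p \in A by apply/mem_set; case: (F_sub p_F).
  by exists (Sub p p_A); rewrite ?mem_listed SubK.
rewrite big_allpairs_dep -(big_mkord xpredT (fun m => \sum_(p <- F m L) h p)).
by rewrite /index_iota subn0.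
Qed.

Lemma near_listed (J : {fset A}) :
  \forall N \near \oo, \forall L \near \oo, (J `<=` listed N L)%fset.
Proof.
exists (\max_(x : J) (sz (val (val x))).+1) => // N /= le_N.
have near_J : \forall L \near \oo, forall x : J,
    val (val x) \in F (sz (val (val x))) L.
  by apply: filter_forall => x; apply: F_exhausts; apply/set_mem/(valP (val x)).
apply: filterS near_J => L J_F; apply/fsubsetP => x xJ.
rewrite mem_listed mem_listing (J_F [` xJ]%fset) andbT.
exact: leq_trans (leq_bigmax [` xJ]%fset) le_N.
Qed.

Lemma sums_to_by_size : exists S : R[i], sums_to A f S /\
  (\sum_(0 <= m < N) t m : R[i]^o) @[N --> \oo] --> (S : R[i]^o).
Proof.
have g_ge0 p : 0 <= g p by rewrite -lecR; apply: le_trans (normr_ge0 _) (f_le p).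
have partial_g_le (J : {fset A}) : partial_sum (fun x => g (val x)) J <= M.
  have [N _ /(_ N (leqnn N)) [L _ /(_ L (leqnn L)) sub_J]] := near_listed J.
  apply: le_trans (partial_sum_subset _ sub_J) _ => //.
  by rewrite partial_sum_listed.
have [S S_lim] :=
  cvg_partial_sum_dominated_complex (fun x : A => f_le (val x)) partial_g_le.
exists S; split=> //; apply/cvg_complexP => eps eps_gt0.
have eps2_gt0 : 0 < eps / 2 by rewrite divr_gt0.
have /cvg_complexP/(_ _ eps2_gt0) [J0 _ J0_close] := S_lim.
apply: filterS (near_listed J0) => N N_listed.
have partial_cvg : (\sum_(m < N) \sum_(p <- F m L) f p : R[i]^o) @[L --> \oo] -->
    (\sum_(m < N) t m : R[i]^o).
  by apply: cvg_sum => m; apply: f_cvg.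
have /cvg_complexP/(_ _ eps2_gt0) partial_close := partial_cvg.
have [L [/= sub_L close_L]] := filter_ex (filterI N_listed partial_close).
rewrite big_mkord -[S - _](subrKA (\sum_(m < N) \sum_(p <- F m L) f p)).
apply: le_trans (ler_normD _ _) _; rewrite [eps]splitr rmorphD lerD //.
  by rewrite -partial_sum_listed; apply: J0_close.
by rewrite distrC.
Qed.

End SumsBySize.

(** * The two identities *)

Section Limits.
Local Open Scope classical_set_scope.
Variables (K : numFieldType) (Q : K).
Hypothesis Q_cvg0 : (Q ^+ n : K^o) @[n --> \oo] --> (0 : K^o).
Hypothesis Q_not_unity : not_unity_root Q.

Lemma cvg_qpoch_expr m : (qpoch (Q ^+ n.+1) Q m : K^o) @[n --> \oo] --> (1 : K^o).
Proof.
have -> : 1 = \prod_(i < m) (1 - 0 * Q ^+ i) :> K^o.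
  by rewrite big1 // => i _; rewrite mul0r subr0.
apply: cvg_big => [|i _]; first exact: mul_continuous.
apply: (@cvgB K K^o); first exact: cvg_cst.
apply: (@cvgM K); last exact: cvg_cst.
by rewrite (cvg_shiftS (fun n => Q ^+ n : K^o)).
Qed.

Lemma cvg_qbinom m s :
  (qbinom Q (L%:Z - s%:Z + m%:Z) m : K^o) @[L --> \oo] --> ((qpoch Q Q m)^-1 : K^o).
Proof.
rewrite -(cvg_shiftn s) -[(qpoch Q Q m)^-1]mul1r.
have -> : (fun L => qbinom Q ((L + s)%N%:Z - s%:Z + m%:Z) m : K^o) =
    (fun L => qpoch (Q ^+ L.+1) Q m * (qpoch Q Q m)^-1).
  apply/funext => L; rewrite -qbinom_qpoch_shift //.
  by congr qbinom; lia.
by apply: (@cvgM K); [exact: cvg_qpoch_expr|exact: cvg_cst].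
Qed.

Lemma cvg_bounded_gf e A B C N m t :
  (bounded_gf Q e A B C N m t L : K^o) @[L --> \oo] -->
  (word_sum Q e A B C N m t (fun=> (qpoch Q Q m)^-1) : K^o).
Proof.
apply: cvg_sum => s; apply: cvg_sum => h.
by apply: (@cvgM K); [exact: cvg_cst|exact: cvg_qbinom].
Qed.

End Limits.

Section ComplexNorm.
Local Open Scope classical_set_scope.
Variable R : realType.
Implicit Types x q : R[i].

Lemma normc_ge0 x : 0 <= normc x.
Proof. by rewrite -lecR; apply: (normr_ge0 x). Qed.

Lemma normc_lt1 x : (normc x < 1) = (`|x| < 1).
Proof. by rewrite -ltcR. Qed.

Lemma normcX x n : normc (x ^+ n) = normc x ^+ n.
Proof.
elim: n => [|n IH]; first by rewrite !expr0 normc1.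
by rewrite !exprS normcM IH.
Qed.

Lemma normcMX x q n : normc (x * q ^+ n) = normc x * normc q ^+ n.
Proof. by rewrite normcM normcX. Qed.

Lemma cvg_expr_complex q : `|q| < 1 ->
  (q ^+ n : R[i]^o) @[n --> \oo] --> (0 : R[i]^o).
Proof.
rewrite -normc_lt1 => q_lt1; apply/cvg_complexP => eps eps_gt0.
have /cvgrPdist_le/(_ _ eps_gt0) : normc q ^+ n @[n --> \oo] --> (0 : R).
  by apply: cvg_expr; rewrite ger0_norm ?normc_ge0.
apply: filterS => n; rewrite !sub0r !normrN ger0_norm ?exprn_ge0 ?normc_ge0 //.
by rewrite -normcX -lecR.
Qed.

Lemma normc_weight k a b c q mu nu om p : normc (weight k a b c q mu nu om p) =
  weight k a b c (normc q) (normc mu) (normc nu) (normc om) p.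
Proof. by rewrite /weight !normcM !normcX. Qed.

End ComplexNorm.

Section RunBoundedSums.
Local Open Scope classical_set_scope.
Variables (R : realType) (k a b c : nat) (q mu nu om : R[i]).
Hypotheses (a_gt0 : (0 < a)%N) (lt_ab : (a < b)%N) (lt_bc : (b < c)%N)
  (le_ck : (c <= k)%N).
Hypotheses (q_lt1 : `|q| < 1) (mu_lt1 : `|mu * q ^+ a| < 1).

Local Notation Q := (q ^+ k).

Let c_gt0 : (0 < c)%N. Proof. by lia. Qed.

Let k_gt0 : (0 < k)%N. Proof. exact: leq_trans le_ck. Qed.

Let normQ_lt1 : `|Q| < 1.
Proof. by rewrite normrX exprn_ilt1 // -lt0n. Qed.

Let Q_not_unity : not_unity_root Q.
Proof. exact: norm_lt1_not_unity_root. Qed.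

Lemma term_run0 e : term_run k a b c q mu nu om e.+1 0 = 1.
Proof. by rewrite term_run_word_sum // word_sum0 // /qpoch big_ord0 invr1. Qed.

(* The run bound [e] may depend on the length of the partition, so that
   [e m = m] imposes no restriction on runs: both identities are instances. *)
Lemma Rset_run_sums (X : set (seq nat)) (e : nat -> nat) (x : R) :
  (forall p, X p <-> Rset_run a b c k (e (size p)).+1 p) ->
  {homo e : m n / (m <= n)%N} -> 0 <= x ->
  (forall n, \sum_(j < (e n).+1) normc (nu * q ^+ b) ^+ j <= x) ->
  exists S : R[i], sums_to X (weight k a b c q mu nu om) (1 + S) /\
    series_from1_to (fun m => term_run k a b c q mu nu om (e m).+1 m) S.
Proof.
move=> XE e_homo x_ge0 sum_le.
pose t m := term_run k a b c q mu nu om (e m).+1 m.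
pose parts_of m := parts k a b c (e m) m (e m).
have mem_parts_of m L p : p \in parts_of m L <->
    [/\ size p = m, X p & below k c L p].
  by rewrite mem_parts_run_bound //; split=> -[<- /XE Rp lt_p].
have Q_itv : 0 <= normc q ^+ k < 1.
  by rewrite -normcX normc_ge0 normc_lt1 normQ_lt1.
have A_itv : 0 <= normc (mu * q ^+ a) < 1 by rewrite normc_ge0 normc_lt1.
have [M M_ge] := bounded_gf_sum_le Q_itv A_itv (normc_ge0 (nu * q ^+ b))
  (normc_ge0 (om * q ^+ c)) x_ge0.
have [S [S_sum S_series]] : exists S : R[i],
    sums_to X (weight k a b c q mu nu om) S /\
    (\sum_(0 <= m < n) t m : R[i]^o) @[n --> \oo] --> (S : R[i]^o).
  apply: (@sums_to_by_size _ _ _ size _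
    (weight k a b c (normc q) (normc mu) (normc nu) (normc om)) M parts_of).
  - by move=> p; rewrite -normc_weight.
  - by move=> m L; apply: parts_uniq.
  - by move=> m L p /mem_parts_of[].
  - move=> p Xp; exists (head 0%N p) => // L /= le_L; apply/mem_parts_of; split=> //.
    by rewrite /below -addn1 leq_add // (leq_trans le_L) // leq_pmull.
  - move=> N L.
    have normQ_not_unity := itv_not_unity_root Q_itv.
    under eq_bigr => m _ do
      rewrite (sum_weight_parts a_gt0 lt_ab lt_bc le_ck _ _ _
        normQ_not_unity _ _ _ (ltn_ord m)).
    by rewrite -!normcMX; apply: M_ge.
  - move=> m; rewrite /t term_run_word_sum //.
    under eq_fun do
      rewrite (sum_weight_parts a_gt0 lt_ab lt_bc le_ck _ _ _
        Q_not_unity _ _ _ (ltnSn m)).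
    by apply: cvg_bounded_gf => //; apply: cvg_expr_complex.
exists (S - 1); split; first by rewrite addrC subrK.
have := cvg_series_behead S_series; rewrite /t term_run0.
exact.
Qed.

End RunBoundedSums.

Theorem theorem1p5 (R : realType) (k a b c r : nat) (q mu nu om : R[i])
    (ha : (1 <= a)%N) (hab : (a < b)%N) (hbc : (b < c)%N) (hck : (c <= k)%N)
    (hr : (1 <= r)%N) (hq : `|q| < 1) (hmu : `|mu * q ^+ a| < 1) :
  (`|nu * q ^+ b| < 1 ->
     exists S : R[i],
       sums_to (Rset a b c k) (weight k a b c q mu nu om) (1 + S) /\
       series_from1_to (term k a b c q mu nu om) S) /\
  (exists S : R[i],
     sums_to (Rset_run a b c k r) (weight k a b c q mu nu om) (1 + S) /\
     series_from1_to (term_run k a b c q mu nu om r) S).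
Proof.
pose x := normc (nu * q ^+ b).
have x_ge0 : 0 <= x := normc_ge0 _.
split=> [hnu|].
- have x_lt1 : x < 1 by rewrite normc_lt1.
  have -> : term k a b c q mu nu om =
      (fun m => term_run k a b c q mu nu om m.+1 m).
    apply/funext => m; apply: term_term_run => //.
    by apply: norm_lt1_not_unity_root; rewrite normrX exprn_ilt1 //; lia.
  apply: (Rset_run_sums om ha hab hbc hck hq hmu (e := id) (x := (1 - x)^-1)) => //.
  + move=> p; split=> [Rp|[]//]; split=> // -[i []].
    by rewrite addnS ltnNge leq_addl.
  + by rewrite invr_ge0 subr_ge0 ltW.
  + by move=> n; apply: geometric_sum_le; rewrite x_ge0.
- case: r hr => // e _.
  apply: (Rset_run_sums om ha hab hbc hck hq hmu (e := fun=> e)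
    (x := \sum_(j < e.+1) x ^+ j)) => //.
  by apply: sumr_ge0 => j _; rewrite exprn_ge0.
Qed.
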